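(* Let $G=\{x\rightarrow y^2,\ y\rightarrow y^2\}$. For any $n\geqslant 1$, we have $$(xD_{G})^n=\sum_{k=1}^n\sum_{\ell=k}^nC_{n,k,\ell}x^\ell y^{2n-k-\ell}D_{G}^k,$$ where the coefficients $C_{n,k,\ell}$ satisfy the recurrence relation $$C_{n+1,k,\ell}=\ell C_{n,k,\ell}+(2n-k-\ell+1)C_{n,k,\ell-1}+C_{n,k-1,\ell-1},$$ with the initial conditions $C_{1,1,1}=1$ and $C_{1,k,\ell}=0$ if $(k,\ell)\neq (1,1)$. The coefficient $C_{n,k,\ell}$ counts ternary $k$-forests on $[n]$ with $2n-k-\ell$ middle and right leaves. Moreover, $C_{n+1,1,\ell}=C_{n,\ell}$, where $C_{n,\ell}$ is the second-order Eulerian number, i.e., the number of Stirling permutations of order $n$ with $\ell$ descents.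
   Context: Grammars: a grammar $G$ on commuting variables is a set of substitution rules $v\rightarrow f_v$; $D_G$ is the derivation (linear, Leibniz rule, killing constants) on functions (e.g. polynomials) in the variables with $D_G(v)=f_v$. For a function $w$, $wD_G$ is the operator $f\mapsto wD_G(f)$, and $(wD_G)^n$ is its $n$-fold composition; in expansions $\sum_k c_kD_G^k$ the functions $c_k$ act by multiplication. Trees: a planted ternary increasing plane tree on a finite set $S$ of $m\ge 1$ positive integers is a rooted plane tree with $m$ internal vertices labeled bijectively by $S$ and $2m-1$ unlabeled leaves such that: (i) the vertex with the smallest label is the root, and it has exactly one child; (ii) every other internal vertex has exactly three ordered children: left, middle, right (each an internal vertex or a leaf); (iii) labels increase along the path from the root to any internal vertex. A middle (right) leaf is a leaf that is the middle (right) child of its parent; a leaf that is the single child of the root is neither. The quantity ''$2n-k-\ell$ middle and right leaves'' is the total number of middle leaves and right leaves in the forest. A ternary $k$-forest on $[n]=\{1,\dots,n\}$ is a sequence of $k$ planted ternary increasing plane trees whose label sets form a partition of $[n]$, with root labels increasing from left to right. A Stirling permutation of order $n$ is a word $\sigma=\sigma_1\cdots\sigma_{2n}$ that is a permutation of the multiset $\{1^2,2^2,\ldots,n^2\}$ such that $\sigma_s\geqslant\sigma_i$ whenever $\sigma_i=\sigma_j$ and $i<s<j$. With $\sigma_0=\sigma_{2n+1}=0$, a descent of $\sigma$ is an index $0\leqslant i\leqslant 2n$ with $\sigma_i>\sigma_{i+1}$. *)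

(* Defs.v *)
From HB Require Import structures.
From mathcomp Require Import all_boot all_order all_algebra.
From mathcomp Require Import mpoly.

Set Implicit Arguments.
Unset Strict Implicit.
Unset Printing Implicit Defensive.

Import GRing.Theory.
Local Open Scope ring_scope.

(* A grammar on m commuting variables over K: rule i rewrites variable i. *)
Definition grammar (K : comNzRingType) (m : nat) := m.-tuple {mpoly K[m]}.

(* [D] is the derivation of the grammar [G] on the algebra [A] of functions
   in the variables [v].  That [D] kills the constants [c%:A] follows from
   linearity and Leibniz, see [grammar_derivation_const]. *)
Definition grammar_derivation (K : comNzRingType) (m : nat) (G : grammar K m)
    (A : comAlgType K) (v : m.-tuple A) (D : A -> A) : Prop :=
  [/\ (forall (c : K) (f g : A), D (c *: f + g) = c *: D f + D g),
      (forall f g : A, D (f * g) = D f * g + f * D g)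
    & (forall i : 'I_m,
         D (tnth v i) = mmap (in_alg A) (tnth v) (tnth G i))].

Lemma grammar_derivation_const (K : comNzRingType) (m : nat) (G : grammar K m)
    (A : comAlgType K) (v : m.-tuple A) (D : A -> A) (c : K) :
  grammar_derivation G v D -> D c%:A = 0.
Proof.
case=> linD leibD _.
have D1 : D 1 = 0.
  have := leibD 1 1; rewrite mulr1 mulr1 mul1r => h.
  by apply: (addrI (D 1)); rewrite addr0 -h.
have D0 : D 0 = 0.
  by have := leibD 0 0; rewrite mul0r mulr0 mul0r addr0.
by have := linD c 1 0; rewrite D1 D0 !addr0 scaler0.
Qed.

(* The derivation of [G] on the polynomials in the variables. *)
Definition grammar_D (K : comNzRingType) (m : nat) (G : grammar K m)
    (f : {mpoly K[m]}) : {mpoly K[m]} :=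
  \sum_(i < m) tnth G i * f^`M(i).

Lemma grammar_DP (K : comNzRingType) (m : nat) (G : grammar K m) :
  grammar_derivation G [tuple 'X_i | i < m] (grammar_D G).
Proof.
split=> [c f g|f g|i]; rewrite /grammar_D.
- rewrite scaler_sumr -big_split /=; apply: eq_bigr => i _.
  by rewrite mderivD mderivZ mulrDr scalerAr.
- rewrite mulr_suml mulr_sumr -big_split /=; apply: eq_bigr => i _.
  by rewrite mderivM mulrDr !mulrA (mulrC f).
- rewrite tnth_mktuple (bigD1 i) //= big1 => [|j ji]; last first.
    by rewrite mderivX mnm1E eq_sym (negPf ji) scale0r mulr0.
  rewrite mderivX mnm1E eqxx scale1r (_ : (U_(i) - U_(i))%MM = 0%MM) ?mpolyX0 ?mulr1 ?addr0; last first.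
    by apply/mnmP => j; rewrite mnmBE mnm0E subnn.
  rewrite {1}[tnth G i]mpolyE /mmap; apply: eq_bigr => u _.
  rewrite /= mulr_algl; congr (_ *: _).
  rewrite mpolyXE_id /mmap1; apply: eq_bigr => j _.
  by rewrite tnth_mktuple.
Qed.

(* Variable 0 is x and variable 1 is y: x -> y^2, y -> y^2. *)
Definition gramG (K : comNzRingType) : grammar K 2 :=
  [tuple 'X_1 ^+ 2; 'X_1 ^+ 2].

Local Open Scope nat_scope.

(* Ternary plane trees: a leaf, or a labeled internal vertex with its left,
   middle and right children. *)
Inductive tern := Leaf | Node of nat & tern & tern & tern.

Fixpoint tern_encode (t : tern) : GenTree.tree nat :=
  if t is Node a l m r then
    GenTree.Node a [:: tern_encode l; tern_encode m; tern_encode r]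
  else GenTree.Leaf 0.

Fixpoint tern_decode (t : GenTree.tree nat) : tern :=
  if t is GenTree.Node a [:: l; m; r] then
    Node a (tern_decode l) (tern_decode m) (tern_decode r)
  else Leaf.

Lemma tern_encodeK : cancel tern_encode tern_decode.
Proof. by elim=> //= a l -> m -> r ->. Qed.

HB.instance Definition _ := Countable.copy tern (can_type tern_encodeK).

Definition is_leaf (t : tern) : bool := if t is Leaf then true else false.

Fixpoint tern_labels (t : tern) : seq nat :=
  if t is Node a l m r then
    a :: tern_labels l ++ tern_labels m ++ tern_labels r
  else [::].

(* Labels increase downwards and all exceed [a]. *)
Fixpoint increasing_above (a : nat) (t : tern) : bool :=
  if t is Node b l m r then
    [&& a < b, increasing_above b l, increasing_above b m
      & increasing_above b r]
  else true.

(* Number of middle leaves and right leaves. *)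
Fixpoint tern_mr_leaves (t : tern) : nat :=
  if t is Node _ l m r then
    is_leaf m + is_leaf r
      + (tern_mr_leaves l + tern_mr_leaves m + tern_mr_leaves r)
  else 0.

(* A planted tree is its root label together with the single child of the
   root; if that child is a leaf, it is neither a middle nor a right leaf. *)
Definition planted := (nat * tern)%type.

Definition planted_labels (t : planted) : seq nat := t.1 :: tern_labels t.2.

Definition planted_mr_leaves (t : planted) : nat := tern_mr_leaves t.2.

(* In particular the root carries the smallest label. *)
Definition planted_increasing (t : planted) : bool := increasing_above t.1 t.2.

(* The [perm_eq] condition says that the labels are pairwise distinct within
   each tree and that the label sets partition {1, ..., n}. *)
Definition is_forest (n k : nat) (F : seq planted) : bool :=
  [&& size F == k, all planted_increasing F,
      perm_eq (flatten [seq planted_labels t | t <- F]) (iota 1 n)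
    & sorted ltn [seq t.1 | t <- F]].

Definition forest_mr_leaves (F : seq planted) : nat :=
  \sum_(t <- F) planted_mr_leaves t.

(* s_i for a word s = s_1 ... s_r, with s_0 = s_{r+1} = 0. *)
Definition entry (s : seq nat) (i : nat) : nat := nth 0 (0 :: s) i.

Definition is_stirling_perm (n : nat) (s : seq nat) : Prop :=
  perm_eq s (flatten [seq [:: i; i] | i <- iota 1 n]) /\
  forall i t j : nat, 1 <= i -> i < t -> t < j -> j <= 2 * n ->
    entry s i = entry s j -> entry s i <= entry s t.

(* Number of indices 0 <= i <= r with s_i > s_{i+1}, where r = size s. *)
Definition descents (s : seq nat) : nat :=
  count (fun i => entry s i.+1 < entry s i) (iota 0 (size s).+1).

(* Exactly [c] elements of [T] satisfy [P]. *)
Definition has_card (T : eqType) (P : T -> Prop) (c : nat) : Prop :=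
  exists s : seq T, [/\ uniq s, (forall x : T, x \in s <-> P x) & size s = c].

(* Main.v *)
Require Import Defs.
From HB Require Import structures.
From mathcomp Require Import all_boot all_order all_algebra.
From mathcomp Require Import mpoly zify ring.

(** The coefficients are defined by their recurrence, and each reading of them
    is shown to obey it.

    Expansion.  By the Leibniz rule, applying [x D] to [x^l y^m D^k] with
    [D x = D y = y^2] gives
      [l x^l y^(m+2) D^k + m x^(l+1) y^(m+1) D^k + x^(l+1) y^m D^(k+1)]
    ([derivation_term]), and with [m = 2n - k - l] the three terms are those of
    the recurrence.

    Uniqueness.  Applied to the power [y^m], the operator [D^k] yields the
    rising factorial [m (m+1) ... (m+k-1)] times [y^(m+k)].  Comparing the
    coefficients of one monomial for all [m] gives, for each [l], a linear
    relation between rising factorials of lengths [k]; these are linearly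
    independent as functions of [m] ([rising_factorials_free]).

    Forests.  Every forest on [n+1] arises from exactly one forest on [n] by
    putting the label [n+1] on a leaf, or by appending it as a new
    one-vertex tree.  Let [l] count the leaves that are neither middle nor right.
    Then there are [l] leaves whose replacement leaves [l] unchanged, there are
    [2n - k - l] middle and right leaves whose replacement increases [l] by one,
    and the new tree increases [k] and [l] by one: this is the recurrence
    ([sum_forest_ins], [xD_coef_forests]).

    Stirling permutations.  In one of order [n+1] the two copies of [n+1] are
    adjacent, so it arises from exactly one of order [n] by inserting them in one
    of the [2n+1] gaps.  A gap that is a descent keeps the number of descents,
    any other gap increases it by one ([sum_double_ins]), which is the recurrence
    for [k = 1], shifted by one in [n] ([xD_coef_stirling]).

    Both combinatorial parts turn such a generation rule into a duplicate-free
    list by [enum_children]. *)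

Set Implicit Arguments.
Unset Strict Implicit.
Unset Printing Implicit Defensive.

Import Order.TTheory GRing.Theory Num.Theory.

(** * The coefficients *)

(** Starting from [n = 0], where the operator power is the identity, makes the
    case [n = 1] an instance of the recurrence.  The subtraction on naturals
    is harmless: where it truncates, the coefficient after it vanishes
    ([xD_coef_supp]). *)
Fixpoint xD_coef (n k l : nat) : nat :=
  if n is n'.+1 then
    if l is l'.+1 then
      l * xD_coef n' k l + (2 * n' - k - l') * xD_coef n' k l'
        + (if k is k'.+1 then xD_coef n' k' l' else 0)
    else 0
  else (k == 0) && (l == 0).

Lemma xD_coef_supp n k l : xD_coef n k l != 0 -> k <= l <= n.
Proof.
elim: n k l => [|n IHn] k [|l] //=; try by case: k.
have := (IHn k l.+1, IHn k l).
case: (altP (xD_coef n k l.+1 =P 0)) => [->|_ [/(_ isT) + _] _]; last by lia.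
case: (altP (xD_coef n k l =P 0)) => [->|_ [_ /(_ isT)]]; last by lia.
by case: k => [|k] _; rewrite ?muln0 // !add0n => /IHn; lia.
Qed.

Lemma xD_coef_out n k l : ~~ (k <= l <= n) -> xD_coef n k l = 0.
Proof. by apply: contraNeq => /xD_coef_supp. Qed.

Lemma xD_coef0 n l : 0 < n -> xD_coef n 0 l = 0.
Proof.
case: n => // n _; elim: n l => [|n IHn] [|l] //.
  by case: l => // l; rewrite /= !muln0.
have -> : xD_coef n.+2 0 l.+1 =
  l.+1 * xD_coef n.+1 0 l.+1 + (2 * n.+1 - 0 - l) * xD_coef n.+1 0 l + 0 by [].
by rewrite !IHn !muln0.
Qed.

Lemma xD_coefS n k l :
  xD_coef n.+1 k.+1 l.+1 =
    l.+1 * xD_coef n k.+1 l.+1 + (2 * n - k.+1 - l) * xD_coef n k.+1 l + xD_coef n k l.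
Proof. by []. Qed.

(** Over the integers the factor [2n - k - l + 1] may be negative, but by
    [xD_coef_supp] the coefficient next to it is then zero. *)
Lemma xD_coef_rec_int n k l : 1 <= k -> 1 <= l ->
  ((xD_coef n.+1 k l)%:Z =
       l%:Z * (xD_coef n k l)%:Z
       + ((2 * n)%:Z - k%:Z - l%:Z + 1) * (xD_coef n k l.-1)%:Z
       + (xD_coef n k.-1 l.-1)%:Z)%R.
Proof.
case: k l => // k [] // l _ _; rewrite xD_coefS /=.
have [/eqP->|/xD_coef_supp] := boolP (xD_coef n k.+1 l == 0); nia.
Qed.

Local Open Scope ring_scope.

(** * Expansion of the powers of the operator *)

Section Derivation.
Variables (K : comNzRingType) (A : comAlgType K) (x y : A) (D : A -> A).
Hypothesis D_G : grammar_derivation (gramG K) [tuple x; y] D.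

Lemma derivationD f g : D (f + g) = D f + D g.
Proof. by have [lin _ _] := D_G; have := lin 1 f g; rewrite !scale1r. Qed.

Lemma derivation0 : D 0 = 0.
Proof. by have [_ leib _] := D_G; have := leib 0 0; rewrite !mul0r mulr0 addr0. Qed.

Lemma derivationM f g : D (f * g) = D f * g + f * D g.
Proof. by have [_ leib _] := D_G. Qed.

Lemma derivation_sum (I : Type) (r : seq I) (F : I -> A) :
  D (\sum_(i <- r) F i) = \sum_(i <- r) D (F i).
Proof. exact: (big_morph D derivationD derivation0). Qed.

Lemma derivation_nat n : D n%:R = 0.
Proof. by rewrite -scaler_nat (grammar_derivation_const _ D_G). Qed.

Lemma derivation_x : D x = y ^+ 2.
Proof.
have [_ _ /(_ ord0)] := D_G.
by rewrite !(tnth_nth 0) /= rmorphXn /= mmapX mmap1U (tnth_nth 0).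
Qed.

Lemma derivation_y : D y = y ^+ 2.
Proof.
have [_ _ /(_ (lift ord0 ord0))] := D_G.
by rewrite !(tnth_nth 0) /= rmorphXn /= mmapX mmap1U (tnth_nth 0).
Qed.

(** The outer factor [x] restores the power lost by differentiation, which
    keeps the case [l = 0] free of an exponent [l - 1]. *)
Lemma derivation_xX l : x * D (x ^+ l) = l%:R * x ^+ l * y ^+ 2.
Proof.
elim: l => [|l IHl]; first by rewrite expr0 (derivation_nat 1) !mul0r mulr0.
by rewrite exprS derivationM derivation_x mulrDr mulrCA IHl exprS; ring.
Qed.

Lemma derivation_yX m : D (y ^+ m) = m%:R * y ^+ m.+1.
Proof.
elim: m => [|m IHm]; first by rewrite expr0 (derivation_nat 1) mul0r.
by rewrite exprS derivationM derivation_y IHm !exprS; ring.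
Qed.

(** The three summands come from differentiating the power of [x], the power
    of [y] and the operand; each is again a monomial times an iterate of [D],
    and they are the three terms of the recurrence. *)
Lemma derivation_term (c l m : nat) g :
  x * D (c%:R * (x ^+ l * y ^+ m) * g) =
    (l * c)%:R * (x ^+ l * y ^+ m.+2) * g
    + (m * c)%:R * (x ^+ l.+1 * y ^+ m.+1) * g
    + c%:R * (x ^+ l.+1 * y ^+ m) * D g.
Proof.
rewrite !derivationM derivation_nat mul0r add0r derivation_yX.
have := derivation_xX l; set Dx := D (x ^+ l) => xDx.
transitivity (c%:R * (x * Dx * y ^+ m + x ^+ l.+1 * (m%:R * y ^+ m.+1)) * g
  + c%:R * (x ^+ l.+1 * y ^+ m) * D g); first by rewrite !exprS; ring.
by rewrite xDx !exprS; ring.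
Qed.

Definition shift (T : nat -> A) (l : nat) : A := if l is l'.+1 then T l' else 0.

Lemma sum_shift (N : nat) (T : nat -> A) :
  T N = 0 -> \sum_(l < N.+1) T l = \sum_(l < N.+1) shift T l.
Proof. by move=> TN; rewrite big_ord_recr big_ord_recl /= TN addr0 add0r. Qed.

(** The triangular range of summation is replaced by a square of fixed size [N],
    the added coefficients being zero.  The square does not grow with [n], so
    the induction only reindexes inside it, and the terms that a shift
    would push over the border vanish. *)
Lemma xD_expansion_square n N f : (n <= N)%N ->
  iter n (fun g => x * D g) f =
  \sum_(k < N.+1) \sum_(l < N.+1)
     (xD_coef n k l)%:R * (x ^+ l * y ^+ (2 * n - k - l)) * iter k D f.
Proof.
elim: n => [|n IHn] nN.
  rewrite (bigD1 ord0) //= (bigD1 ord0) //= [X in _ + X + _]big1 => [|l]; last first.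
    by rewrite -val_eqE /= => /negPf->; rewrite !mul0r.
  rewrite big1 ?addr0 ?expr0 ?mul1r // => k.
  by rewrite -val_eqE /= => /negPf k0; rewrite big1 // => l _; rewrite k0 !mul0r.
have CS0 k : xD_coef n.+1 k 0 = 0%N by [].
have CSS k l : xD_coef n.+1 k l.+1 = (l.+1 * xD_coef n k l.+1
    + (2 * n - k - l) * xD_coef n k l
    + (if k is k'.+1 then xD_coef n k' l else 0))%N by [].
rewrite iterS IHn 1?ltnW // derivation_sum mulr_sumr.
(* opaque from here on, lest simplification unfold the recurrence *)
move: (xD_coef n.+1) CS0 CSS => C' CS0 CSS.
pose T1 k l := (l * xD_coef n k l)%:R
  * (x ^+ l * y ^+ (2 * n - k - l).+2) * iter k D f.
pose T2 k l := ((2 * n - k - l) * xD_coef n k l)%:R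
  * (x ^+ l.+1 * y ^+ (2 * n - k - l).+1) * iter k D f.
pose T3 k l := (xD_coef n k l)%:R
  * (x ^+ l.+1 * y ^+ (2 * n - k - l)) * iter k.+1 D f.
have TE k : x * D (\sum_(l < N.+1) (xD_coef n k l)%:R
      * (x ^+ l * y ^+ (2 * n - k - l)) * iter k D f) =
    \sum_(l < N.+1) T1 k l + \sum_(l < N.+1) T2 k l + \sum_(l < N.+1) T3 k l.
  rewrite derivation_sum mulr_sumr -!big_split.
  by apply: eq_bigr => l _; rewrite derivation_term.
under eq_bigr => k _ do rewrite TE.
have C_N k : xD_coef n k N = 0%N.
  by apply: xD_coef_out; rewrite negb_and -!ltnNge nN orbT.
have N_C l : xD_coef n N l = 0%N.
  by apply: xD_coef_out; lia.
(* The exponents of [y] agree only where no subtraction truncates, that is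
   wherever the coefficient is nonzero. *)
have same_exp c i j u v : (c != 0%N -> i = j) ->
    c%:R * (u * y ^+ i) * v = c%:R * (u * y ^+ j) * v :> A.
  by case: (altP (c =P 0%N)) => [->|_ ->]; rewrite ?mul0r.
rewrite !big_split /=.
rewrite [X in _ + X](@sum_shift N (fun k => \sum_(l < N.+1) T3 k l)); last first.
  by rewrite big1 // => l _; rewrite /T3 N_C !mul0r.
rewrite -!big_split; apply: eq_bigr => k _ /=.
rewrite (@sum_shift N (T2 k)); last by rewrite /T2 C_N muln0 !mul0r.
have -> : shift (fun k => \sum_(l < N.+1) T3 k l) k =
    \sum_(l < N.+1) shift (fun k => shift (T3 k) l) k.
  case: (nat_of_ord k) => [|k'] /=; first by rewrite big1.
  by rewrite (@sum_shift N (T3 k')) // /T3 C_N !mul0r.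
rewrite -!big_split; apply: eq_bigr => l _ /=.
case: (nat_of_ord l) (nat_of_ord k) => {k l} [|l] k.
  by rewrite CS0 /T1 /= !mul0r; case: k => [|k]; rewrite /= !addr0.
rewrite CSS 2!natrD !mulrDl /T1 /T2 /T3 /=; congr (_ + _ + _).
- by apply: same_exp; rewrite muln_eq0 => /norP[_ /xD_coef_supp]; lia.
- by apply: same_exp; rewrite muln_eq0 => /norP[+ /xD_coef_supp]; lia.
- case: k => [|k]; first by rewrite !mul0r.
  by apply: same_exp; lia.
Qed.

Lemma xD_expansion n f : (1 <= n)%N ->
  iter n (fun g => x * D g) f =
  \sum_(1 <= k < n.+1) \sum_(k <= l < n.+1)
     (xD_coef n k l)%:R * (x ^+ l * y ^+ (2 * n - k - l)) * iter k D f.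
Proof.
move=> n_gt0; rewrite (xD_expansion_square f (leqnn n)).
pose T k l := (xD_coef n k l)%:R * (x ^+ l * y ^+ (2 * n - k - l)) * iter k D f.
rewrite -(big_mkord xpredT (fun k => \sum_(l < n.+1) T k l)) big_ltn // big1; last first.
  by move=> l _; rewrite /T xD_coef0 // !mul0r.
rewrite add0r; apply: eq_big_nat => k /andP[_ kn].
rewrite -(big_mkord xpredT (T k)) (big_cat_nat (leq0n k) (ltnW kn)).
rewrite big1_seq /= ?add0r //.
move=> l; rewrite mem_index_iota /T => /andP[_ lk].
by rewrite xD_coef_out ?mul0r // negb_and -ltnNge lk.
Qed.

End Derivation.

(** * Uniqueness of the expansion *)

(** The sum is the value at [m] of a polynomial in [m] with infinitely many
    roots, so it may also be evaluated at the negative integers.  At [-j] the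
    products with more than [j] factors vanish and the product with [j] factors
    does not: the system is triangular and [d j] is determined by induction. *)
Lemma rising_factorials_free (n : nat) (d : nat -> rat) :
  (forall m : nat, \sum_(k < n) d k * \prod_(i < k) (m + i)%:R = 0) ->
  forall k, (k < n)%N -> d k = 0.
Proof.
move=> d_free.
pose p : {poly rat} := \sum_(k < n) d k *: \prod_(i < k) ('X + i%:R%:P).
have pE a : p.[a] = \sum_(k < n) d k * \prod_(i < k) (a + i%:R).
  rewrite /p horner_sum; apply: eq_bigr => k _; rewrite hornerZ horner_prod.
  by congr (_ * _); apply: eq_bigr => i _; rewrite hornerD hornerX hornerC.
have p0 : p = 0.
  apply: (@roots_geq_poly_eq0 _ p [seq m%:R | m <- iota 0 (size p)]).
  - apply/allP => _ /mapP[m _ ->]; rewrite rootE pE -[X in _ == X](d_free m).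
    by apply/eqP/eq_bigr => k _; congr (_ * _); apply: eq_bigr => i _; rewrite natrD.
  - by rewrite map_inj_uniq ?iota_uniq // => i j /eqP; rewrite eqr_nat => /eqP.
  - by rewrite size_map size_iota.
elim/ltn_ind => j IHj jn.
have other0 (k : 'I_n) : k != Ordinal jn ->
    d k * \prod_(i < k) (- j%:R + i%:R) = 0.
  rewrite -val_eqE /= => kj; case: (ltnP k j) => [kj'|jk]; first by rewrite IHj ?mul0r.
  have jk' : (j < k)%N by rewrite ltn_neqAle jk andbT eq_sym.
  by rewrite (bigD1 (Ordinal jk')) //= addNr mul0r mulr0.
have := pE (- j%:R); rewrite p0 horner0 (bigD1 (Ordinal jn)) //= (eq_bigr _ other0).
rewrite big1_eq addr0 => /esym/eqP; rewrite mulf_eq0 => /orP[/eqP //|].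
rewrite prodf_seq_eq0 => /hasP[i _] /=.
by rewrite addrC subr_eq0 eqr_nat (ltn_eqF (ltn_ord i)).
Qed.

Lemma gramG_derivation (K : comNzRingType) :
  grammar_derivation (gramG K) [tuple 'X_0; 'X_1] (grammar_D (gramG K)).
Proof.
suff -> : [tuple 'X_0; 'X_1] = [tuple 'X_i | i < 2] :> 2.-tuple {mpoly K[2]}.
  exact: grammar_DP.
by apply: eq_from_tnth => i; rewrite tnth_mktuple (tnth_nth 0);
  case: i => [[|[|//]]] i2 /=; congr 'X_ _; apply: val_inj.
Qed.

Lemma iter_derivation_yX (K : comNzRingType) (A : comAlgType K) (x y : A)
    (D : A -> A) k m : grammar_derivation (gramG K) [tuple x; y] D ->
  iter k D (y ^+ m) = (\prod_(i < k) (m + i))%:R * y ^+ (m + k).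
Proof.
move=> D_G; elim: k => [|k IHk]; first by rewrite big_ord0 mul1r addn0.
rewrite iterS IHk (derivationM D_G) (derivation_nat D_G) mul0r add0r.
by rewrite (derivation_yX D_G) big_ord_recr /= natrM addnS mulrA.
Qed.

Lemma mcoeff_XY (l l' i j : nat) :
  ('X_0 ^+ l * 'X_1 ^+ i : {mpoly rat[2]})@_(U_(0) *+ l' + U_(1) *+ j) =
    ((l == l') && (i == j))%:R.
Proof.
rewrite !mpolyXn -mpolyXD mcoeffX; congr (nat_of_bool _)%:R.
apply/eqP/andP => [/mnmP E|[/eqP-> /eqP->]//].
have := (E ord0, E (lift ord0 ord0)); rewrite !mnmDE !mulmnE !mnm1E /=.
by rewrite ?muln1 ?mul1n ?muln0 ?mul0n ?addn0 ?add0n => -[-> ->].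
Qed.

(** Testing on the powers of [y] is enough, because [D^k y^m] is the rising
    factorial [m (m+1) ... (m+k-1)] times [y^(m+k)].  In the difference of the
    two expansions the monomial [x^l y^(2n-l+m)] collects the terms of a single
    [l] and all [k], since [D^k] contributes the missing [k] to the
    exponent of [y]. *)
Lemma xD_expansion_unique n (c : nat -> nat -> rat) :
  (1 <= n)%N ->
  (forall f : {mpoly rat[2]},
     iter n (fun g => 'X_0 * grammar_D (gramG rat) g) f =
     \sum_(1 <= k < n.+1) \sum_(k <= l < n.+1)
        c k l *: ('X_0 ^+ l * 'X_1 ^+ (2 * n - k - l)
                    * iter k (grammar_D (gramG rat)) f)) ->
  forall k l : nat, (1 <= k <= l)%N -> (l <= n)%N -> c k l = (xD_coef n k l)%:R.
Proof.
move=> n_gt0 expc k l /andP[k_gt0 kl] ln.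
(* zero outside [1 <= j <= l], the indices that occur with this [l] *)
pose d j := if (0 < j <= l)%N then c j l - (xD_coef n j l)%:R else 0.
suff: d k = 0 by rewrite /d k_gt0 kl => /subr0_eq.
apply: (@rising_factorials_free n.+1 d); last by apply: leq_trans kl _.
move=> m; pose D := grammar_D (gramG rat).
have D_G := gramG_derivation rat.
have := expc ('X_1 ^+ m); rewrite (xD_expansion D_G) // => /eqP.
rewrite eq_sym -subr_eq0 -sumrB.
have termE j i : c j i *: ('X_0 ^+ i * 'X_1 ^+ (2 * n - j - i) * iter j D ('X_1 ^+ m))
    - (xD_coef n j i)%:R * ('X_0 ^+ i * 'X_1 ^+ (2 * n - j - i)) * iter j D ('X_1 ^+ m)
  = ((c j i - (xD_coef n j i)%:R) * (\prod_(i < j) (m + i))%:R)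
      *: ('X_0 ^+ i * 'X_1 ^+ (2 * n - j - i + (m + j))) :> {mpoly rat[2]}.
  rewrite (iter_derivation_yX _ _ D_G) -!mul_mpolyC mpolyCM mpolyCB.
  by rewrite !mpolyC_nat !exprD; ring.
under eq_bigr => j _ do (rewrite -sumrB; under eq_bigr => i _ do rewrite termE).
move/eqP/(congr1 (mcoeff (U_(0) *+ l + U_(1) *+ (2 * n - l + m)))).
set mon := (X in mcoeff X _).
have mcoeff_sum := big_morph (mcoeff mon) (mcoeffD mon) (mcoeff0 _ mon).
rewrite mcoeff0 mcoeff_sum => E; rewrite -[RHS]E.
rewrite -(big_mkord xpredT (fun j => d j * \prod_(i < j) (m + i)%:R)) big_ltn //.
rewrite {1}/d mul0r add0r; apply: eq_big_nat => j /andP[j_gt0 jn].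
transitivity (\sum_(j <= i < n.+1) (c j i - (xD_coef n j i)%:R)
    * (\prod_(i < j) (m + i))%:R
    * ((i == l) && (2 * n - j - i + (m + j) == 2 * n - l + m)%N)%:R); last first.
  rewrite mcoeff_sum; apply: eq_bigr => i _; rewrite -mcoeff_XY.
  by symmetry; apply: mcoeffZ.
rewrite /d j_gt0 /=.
case: (leqP j l) => [jl|lj]; last first.
  rewrite mul0r big1_seq // => i; rewrite mem_index_iota => /andP[_ /andP[ji _]].
  by rewrite (gtn_eqF (leq_trans lj ji)) mulr0.
rewrite (bigD1_seq l) ?iota_uniq ?mem_index_iota ?jl //=.
rewrite [\sum_(i <- _ | _) _]big1 => [|i /negPf->]; last by rewrite mulr0.
have -> : (2 * n - j - l + (m + j) == 2 * n - l + m)%N by apply/eqP; lia.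
by rewrite eqxx mulr1 natr_prod; symmetry; apply: addr0.
Qed.

Local Close Scope ring_scope.

(** * Enumeration by children *)

(** Lists for the objects of successive sizes are obtained by listing children:
    each new object is a child of exactly one old object, its parent, so no
    object is listed twice and none is missed. *)
Lemma enum_children (T : eqType) (P Q : T -> Prop) (ch : T -> seq T)
    (par : T -> T) (s : seq T) :
  uniq s -> (forall x, x \in s <-> P x) ->
  (forall x, P x -> uniq (ch x)) ->
  (forall x y, P x -> y \in ch x -> Q y /\ par y = x) ->
  (forall y, Q y -> P (par y) /\ y \in ch (par y)) ->
  uniq (flatten [seq ch x | x <- s]) /\
  (forall y, y \in flatten [seq ch x | x <- s] <-> Q y).
Proof.
move=> us sP uch chQ Qch; split; last first.
  move=> y; split=> [/flatten_mapP[x /sP Px /(chQ _ _ Px)[]] //|/Qch[Py yc]].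
  by apply/flatten_mapP; exists (par y) => //; apply/sP.
have {sP}: {in s, forall x, P x} by move=> x /sP.
elim: s us => //= x s IHs /andP[xs us] sP.
have Px : P x by apply: sP; rewrite mem_head.
have {}sP : {in s, forall x, P x} by move=> z zs; apply: sP; rewrite in_cons zs orbT.
rewrite cat_uniq uch // IHs // andbT /=; apply/hasPn => y /flatten_mapP[z zs yz].
apply: contra xs => /(chQ _ _ Px)[_ <-].
by have [_ ->] := chQ _ _ (sP z zs) yz.
Qed.

Lemma has_card_filter (T : eqType) (s : seq T) (Q P : T -> Prop) (p : pred T) :
  uniq s -> (forall x, x \in s <-> Q x) -> (forall x, P x <-> Q x /\ p x) ->
  has_card P (count p s).
Proof.
move=> us sQ PQ; exists (filter p s); split; rewrite ?filter_uniq ?size_filter //.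
move=> x; rewrite mem_filter; split=> [/andP[px /sQ Qx]|/PQ[/sQ -> ->]] //.
by apply/PQ.
Qed.

Lemma count_sum (T : Type) (p : pred T) (s : seq T) :
  count p s = \sum_(x <- s) p x.
Proof. by rewrite -sum1_count big_mkcond; apply: eq_bigr => x _; case: (p x). Qed.

(** * Inserting the largest label into a ternary tree *)

Fixpoint tern_left_leaves (t : tern) : nat :=
  if t is Node _ l m r then
    is_leaf l + (tern_left_leaves l + tern_left_leaves m + tern_left_leaves r)
  else 0.

(** The leaves that are neither middle nor right: left leaves, and the child
    of the root when it is a leaf.  In a forest their number is the exponent
    of [x]. *)
Definition outer_leaves (t : planted) := is_leaf t.2 + tern_left_leaves t.2.

Definition forest_outer_leaves (F : seq planted) := \sum_(t <- F) outer_leaves t.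

(** A ternary tree with [s] internal vertices has [2s + 1] leaves; the tree [t]
    is here the child of a root, so that [t = Leaf] is an outer leaf. *)
Lemma tern_leaves t :
  is_leaf t + tern_left_leaves t + tern_mr_leaves t = 2 * size (tern_labels t) + 1.
Proof. by elim: t => //= a l IHl m IHm r IHr; rewrite !size_cat; lia. Qed.

Definition forest_labels (F : seq planted) := flatten [seq planted_labels t | t <- F].

Lemma forest_leaves F :
  forest_outer_leaves F + forest_mr_leaves F + size F = 2 * size (forest_labels F).
Proof.
rewrite /forest_outer_leaves /forest_mr_leaves /forest_labels.
elim: F => [|[b t] F IHF]; rewrite ?big_nil // !big_cons /= size_cat.
have := tern_leaves t; rewrite {1}/outer_leaves {1}/planted_mr_leaves /=; lia.
Qed.

Fixpoint tern_ins (a : nat) (t : tern) : seq tern :=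
  if t is Node b l m r then
    [seq Node b l' m r | l' <- tern_ins a l]
    ++ [seq Node b l m' r | m' <- tern_ins a m]
    ++ [seq Node b l m r' | r' <- tern_ins a r]
  else [:: Node a Leaf Leaf Leaf].

Fixpoint tern_rem (a : nat) (t : tern) : tern :=
  if t is Node b l m r then
    if b == a then Leaf else Node b (tern_rem a l) (tern_rem a m) (tern_rem a r)
  else Leaf.

Lemma mem_tern_ins a b l m r t' :
  t' \in tern_ins a (Node b l m r) ->
  [\/ exists2 l', l' \in tern_ins a l & t' = Node b l' m r,
      exists2 m', m' \in tern_ins a m & t' = Node b l m' r
    | exists2 r', r' \in tern_ins a r & t' = Node b l m r'].
Proof.
rewrite /= !mem_cat => /or3P[] /mapP[u ? ->].
- by apply: Or31; exists u.
- by apply: Or32; exists u.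
- by apply: Or33; exists u.
Qed.

Lemma tern_ins_labels a t t' :
  t' \in tern_ins a t -> perm_eq (tern_labels t') (a :: tern_labels t).
Proof.
elim: t t' => [|b l IHl m IHm r IHr] t'; first by rewrite inE => /eqP->.
case/mem_tern_ins=> -[u u_ins ->]; apply/permP => p /=; rewrite !count_cat.
- by have /permP/(_ p)/= := IHl _ u_ins; lia.
- by have /permP/(_ p)/= := IHm _ u_ins; lia.
- by have /permP/(_ p)/= := IHr _ u_ins; lia.
Qed.

(** Inserting adds a label, hence changes the tree; this is why insertions in
    different subtrees of a vertex give different trees. *)
Lemma tern_ins_irrefl a t : t \notin tern_ins a t.
Proof.
by apply/negP => /tern_ins_labels/perm_size /=; lia.
Qed.

Lemma tern_ins_uniq a t : uniq (tern_ins a t).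
Proof.
elim: t => //= b l IHl m IHm r IHr.
rewrite !cat_uniq !map_inj_uniq ?IHl ?IHm ?IHr /=; try by move=> ? ? [].
rewrite andbT; apply/andP; split.
- apply/hasPn => t'; rewrite mem_cat => /orP[] /mapP[u _ ->];
    apply/mapP => -[v v_ins [E _]]; move: v_ins;
    by rewrite -E (negPf (tern_ins_irrefl _ _)).
- apply/hasPn => t' /mapP[u _ ->]; apply/mapP => -[v v_ins [E _]].
  by move: v_ins; rewrite -E (negPf (tern_ins_irrefl _ _)).
Qed.

Lemma tern_rem_id a t : a \notin tern_labels t -> tern_rem a t = t.
Proof.
elim: t => //= b l IHl m IHm r IHr.
rewrite in_cons !mem_cat !negb_or eq_sym => /and4P[/negPf-> al am ar].
by rewrite IHl ?IHm ?IHr.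
Qed.

Lemma tern_insK a t t' :
  a \notin tern_labels t -> t' \in tern_ins a t -> tern_rem a t' = t.
Proof.
elim: t t' => [|b l IHl m IHm r IHr] t'.
  by rewrite inE => _ /eqP-> /=; rewrite eqxx.
move=> + t'_ins; rewrite /= in_cons !mem_cat !negb_or eq_sym.
case/and4P=> /negPf ab al am ar; case/mem_tern_ins: t'_ins => -[u u_ins ->] /=; rewrite ab.
- by rewrite (IHl u) // !tern_rem_id.
- by rewrite (IHm u) // !tern_rem_id.
- by rewrite (IHr u) // !tern_rem_id.
Qed.

Lemma tern_ins_increasing a b t t' :
  b < a -> all (gtn a) (tern_labels t) -> increasing_above b t ->
  t' \in tern_ins a t -> increasing_above b t'.
Proof.
elim: t b t' => [|c l IHl m IHm r IHr] b t' ba.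
  by rewrite inE => _ _ /eqP-> /=; rewrite ba.
move=> + + t'_ins; rewrite /= !all_cat => /and4P[ca la ma ra] /and4P[bc il im ir].
by case/mem_tern_ins: t'_ins => -[u u_ins ->] /=; rewrite bc ?il ?im ?ir ?andbT /=;
   [apply: IHl|apply: IHm|apply: IHr].
Qed.

Lemma tern_rem_increasing a b t :
  increasing_above b t -> increasing_above b (tern_rem a t).
Proof.
elim: t b => //= c l IHl m IHm r IHr b /and4P[bc il im ir].
by case: eqP => //= _; rewrite bc IHl ?IHm ?IHr.
Qed.

Lemma increasing_max_leaf a t :
  increasing_above a t -> all (geq a) (tern_labels t) -> t = Leaf.
Proof. by case: t => //= b l m r /and4P[ab _ _ _]; rewrite leqNgt ab. Qed.

Lemma addn2_eq1 p q : p + q = 1 -> p = 0 /\ q = 1 \/ p = 1 /\ q = 0.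
Proof. by case: p q => [|[|p]] [|[|q]] // _; [left|right]. Qed.

Lemma addn3_eq1 p q r : p + (q + r) = 1 ->
  [\/ [/\ p = 1, q = 0 & r = 0], [/\ p = 0, q = 1 & r = 0]
    | [/\ p = 0, q = 0 & r = 1]].
Proof. by case: p q r => [|[|p]] [|[|q]] [|[|r]] // _; constructor. Qed.

(** A vertex carrying the largest label has only leaves as children, so
    removing it leaves a single leaf, where it can be inserted back. *)
Lemma tern_remK a b t :
  increasing_above b t -> all (geq a) (tern_labels t) ->
  count_mem a (tern_labels t) = 1 -> t \in tern_ins a (tern_rem a t).
Proof.
elim: t b => //= c l IHl m IHm r IHr b /and4P[_ il im ir].
rewrite !all_cat => /and4P[_ la ma ra].
case: eqP => [ca _|_].
  rewrite ca in il im ir *.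
  rewrite (increasing_max_leaf il la) (increasing_max_leaf im ma).
  by rewrite (increasing_max_leaf ir ra) mem_head.
rewrite add0n !count_cat => Ea.
have rem0 u : count_mem a (tern_labels u) = 0 -> tern_rem a u = u.
  by move=> E; rewrite tern_rem_id // -has_pred1 has_count E.
rewrite /= !mem_cat; apply/or3P.
case/addn3_eq1: Ea => -[El Em Er].
- apply: Or31; rewrite (rem0 m) // (rem0 r) //.
  exact: (map_f (fun u => Node c u m r) (IHl _ il la El)).
- apply: Or32; rewrite (rem0 l) // (rem0 r) //.
  exact: (map_f (fun u => Node c l u r) (IHm _ im ma Em)).
- apply: Or33; rewrite (rem0 l) // (rem0 m) //.
  exact: (map_f (fun u => Node c l m u) (IHr _ ir ra Er)).
Qed.

(** Inserting at an outer leaf replaces it by a vertex with one outer leaf;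
    inserting at a middle or right leaf adds the left leaf of the new vertex.
    A summand [g] of arbitrary form lets the hypothesis for a subtree
    be used with the contribution of its siblings added to the argument of [g].
    The identity treats [t] as the child of a root or a left child; inside the proof
    [mr_form] rewrites it for a tree in a middle or right position. *)
Lemma sum_tern_ins a t (g : nat -> nat) :
  \sum_(t' <- tern_ins a t) g (tern_left_leaves t') =
    (is_leaf t + tern_left_leaves t) * g (is_leaf t + tern_left_leaves t)
      + tern_mr_leaves t * g (is_leaf t + tern_left_leaves t).+1.
Proof.
have mr_form u h :
    (is_leaf u + tern_left_leaves u) * h (is_leaf u + tern_left_leaves u)
      + tern_mr_leaves u * h (is_leaf u + tern_left_leaves u).+1 =
    tern_left_leaves u * h (tern_left_leaves u)
      + (is_leaf u + tern_mr_leaves u) * h (tern_left_leaves u).+1 :> nat.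
  by case: u => [|? ? ? ?] /=; rewrite !add0n ?mul0n ?addn0.
elim: t g => [|b l IHl m IHm r IHr] g.
  by rewrite big_seq1 /= mul0n !addn0 mul1n.
rewrite /= !big_cat !big_map /= !add0n.
rewrite (eq_big_seq (fun l' =>
    g (tern_left_leaves l' + (tern_left_leaves m + tern_left_leaves r)))); last first.
  by case=> [/tern_ins_labels/perm_size //|*] /=; congr (g _); lia.
rewrite (IHl (fun j => g (j + (tern_left_leaves m + tern_left_leaves r)))).
pose gm j := g (j + (is_leaf l + tern_left_leaves l + tern_left_leaves r)).
rewrite (eq_bigr (fun m' => gm (tern_left_leaves m'))); last first.
  by move=> m' _; rewrite /gm; congr (g _); lia.
pose gr j := g (j + (is_leaf l + tern_left_leaves l + tern_left_leaves m)).
rewrite [\sum_(r' <- tern_ins a r) _]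
  (eq_bigr (fun r' => gr (tern_left_leaves r'))); last first.
  by move=> r' _; rewrite /gr; congr (g _); lia.
rewrite IHm IHr !mr_form /gm /gr.
(* [N] is the number of left leaves of the whole tree: every value of [g] is
   taken at [N] or [N + 1]. *)
have [N defN] : exists N,
    N = is_leaf l + (tern_left_leaves l + tern_left_leaves m + tern_left_leaves r).
  by eexists.
have gE j : j = N -> g j = g N by move->.
have gSE j : j = N -> g j.+1 = g N.+1 by move->.
rewrite !addSn -defN.
do 3! [rewrite (gE (_ + _)); last by rewrite defN; lia].
do 3! [rewrite (gSE (_ + _)); last by rewrite defN; lia].
by lia.
Qed.

(** * Forests *)

(** The new one-vertex tree is put at the end: carrying the largest label, it
    must come last for the root labels to increase. *)
Fixpoint forest_ins (a : nat) (F : seq planted) : seq (seq planted) :=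
  if F is (b, t) :: F' then
    [seq (b, t') :: F' | t' <- tern_ins a t]
    ++ [seq (b, t) :: F'' | F'' <- forest_ins a F']
  else [:: [:: (a, Leaf)]].

Definition forest_rem (a : nat) (F : seq planted) : seq planted :=
  [seq (t.1, tern_rem a t.2) | t <- F & t.1 != a].

Lemma mem_forest_ins a b t F F' :
  F' \in forest_ins a ((b, t) :: F) ->
  (exists2 t', t' \in tern_ins a t & F' = (b, t') :: F) \/
  (exists2 F'', F'' \in forest_ins a F & F' = (b, t) :: F'').
Proof.
by rewrite /= mem_cat => /orP[] /mapP[u ? ->]; [left|right]; exists u.
Qed.

Lemma forest_ins_labels a F F' :
  F' \in forest_ins a F -> perm_eq (forest_labels F') (a :: forest_labels F).
Proof.
rewrite /forest_labels.
elim: F F' => [|[b t] F IHF] F'; first by rewrite inE => /eqP->.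
case/mem_forest_ins=> -[u u_ins ->]; apply/permP => p /=; rewrite !count_cat.
- by have /permP/(_ p)/= := tern_ins_labels u_ins; lia.
- by have /permP/(_ p)/= := IHF _ u_ins; lia.
Qed.

Lemma forest_ins_uniq a F : uniq (forest_ins a F).
Proof.
elim: F => //= -[b t] F IHF.
rewrite cat_uniq !map_inj_uniq ?IHF ?tern_ins_uniq /= ?andbT; try by move=> ? ? [].
apply/hasPn => _ /mapP[u _ ->]; apply/mapP => -[v v_ins [E _]].
by move: v_ins; rewrite -E (negPf (tern_ins_irrefl _ _)).
Qed.

Lemma forest_rem_id a F : a \notin forest_labels F -> forest_rem a F = F.
Proof.
rewrite /forest_labels /forest_rem; elim: F => //= -[b t] F IHF /=.
rewrite in_cons mem_cat !negb_or eq_sym => /and3P[ab at_ aF].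
by rewrite ab /= tern_rem_id // IHF.
Qed.

Lemma forest_insK a F F' :
  a \notin forest_labels F -> F' \in forest_ins a F -> forest_rem a F' = F.
Proof.
elim: F F' => [|[b t] F IHF] F'.
  by rewrite inE => _ /eqP-> /=; rewrite /forest_rem /= eqxx.
move=> + F'_ins; rewrite /= in_cons mem_cat !negb_or eq_sym => /and3P[ab at_ aF].
case/mem_forest_ins: F'_ins => -[u u_ins ->]; rewrite /forest_rem /= ab /=.
- by rewrite (tern_insK at_ u_ins) -/(forest_rem a F) forest_rem_id.
- by rewrite tern_rem_id // -/(forest_rem a u) (IHF u).
Qed.

Lemma forest_ins_increasing a F F' :
  all (gtn a) (forest_labels F) -> all planted_increasing F ->
  F' \in forest_ins a F -> all planted_increasing F'.
Proof.
elim: F F' => [|[b t] F IHF] F'; first by rewrite inE => _ _ /eqP->.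
move=> + + F'_ins; rewrite /= all_cat => /and3P[ba ta Fa] /andP[it iF].
case/mem_forest_ins: F'_ins => -[u u_ins ->] /=.
- by rewrite iF andbT; apply: tern_ins_increasing u_ins.
- by rewrite it (IHF u).
Qed.

Lemma forest_ins_roots a F F' : F' \in forest_ins a F ->
  [seq t.1 | t <- F'] = [seq t.1 | t <- F] \/
  [seq t.1 | t <- F'] = rcons [seq t.1 | t <- F] a.
Proof.
elim: F F' => [|[b t] F IHF] F'; first by rewrite inE => /eqP->; right.
case/mem_forest_ins=> -[u u_ins ->] /=; first by left.
by case: (IHF u u_ins) => ->; [left|right].
Qed.

Lemma roots_sub_labels F : {subset [seq t.1 | t <- F] <= forest_labels F}.
Proof.
move=> _ /mapP[t tF ->]; apply/flatten_mapP; exists t => //.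
by rewrite mem_head.
Qed.

Lemma forest_ins_sorted a F F' :
  all (gtn a) (forest_labels F) -> sorted ltn [seq t.1 | t <- F] ->
  F' \in forest_ins a F -> sorted ltn [seq t.1 | t <- F'].
Proof.
move=> Fa sF /forest_ins_roots[->//|->].
have: all (gtn a) [seq t.1 | t <- F].
  by apply/allP => b /roots_sub_labels; apply: (allP Fa).
case: [seq t.1 | t <- F] sF => //= b s bs bsa; rewrite rcons_path bs /=.
exact: (allP (bsa : all (gtn a) (b :: s)) _ (mem_last b s)).
Qed.

(** If [a] is a root label, it is the last one and the rest of its tree is
    empty; otherwise it occurs in exactly one tree, and [tern_remK] applies. *)
Lemma forest_remK a F :
  all planted_increasing F -> all (geq a) (forest_labels F) ->
  sorted ltn [seq t.1 | t <- F] -> count_mem a (forest_labels F) = 1 ->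
  F \in forest_ins a (forest_rem a F).
Proof.
rewrite /forest_rem.
elim: F => //= -[b t] F IHF /= /andP[it iF].
rewrite all_cat => /and3P[ba ta Fa] bF.
rewrite count_cat -/(forest_labels F).
case: eqP => [ab _ |_]; last rewrite add0n => Ea.
  rewrite -{}ab in ba ta Fa IHF *.
  have -> : F = [::].
    case: F Fa bF {IHF iF} => //= -[c u] F /andP[ca _] /= /andP[bc _].
    by rewrite ltnNge ca in bc.
  by rewrite (increasing_max_leaf (it : increasing_above b t) ta) inE.
rewrite /= mem_cat; apply/orP.
have sF : sorted ltn [seq t.1 | t <- F] by apply: path_sorted bF.
case/addn2_eq1: Ea => -[Et EF].
- right; rewrite tern_rem_id; last by rewrite -has_pred1 has_count Et.
  by apply: map_f; apply: IHF.
- left; rewrite -/(forest_rem a F) forest_rem_id; last first.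
    by rewrite -has_pred1 has_count EF.
  exact: (map_f (fun u => (b, u) :: F) (tern_remK (it : increasing_above b t) ta Et)).
Qed.

Lemma forest_rem_increasing a F :
  all planted_increasing F -> all planted_increasing (forest_rem a F).
Proof.
rewrite /forest_rem; elim: F => //= -[b t] F IHF /= /andP[it iF].
by case: ifP => _ /=; rewrite IHF // ?andbT; apply: tern_rem_increasing.
Qed.

Lemma forest_rem_sorted a F :
  sorted ltn [seq t.1 | t <- F] -> sorted ltn [seq t.1 | t <- forest_rem a F].
Proof.
rewrite /forest_rem -map_comp; apply: (subseq_sorted ltn_trans).
exact: (map_subseq fst (filter_subseq (fun t => t.1 != a) F)).
Qed.

Definition forest (n : nat) (F : seq planted) := is_forest n (size F) F.

Lemma all_gt_iota n s : perm_eq s (iota 1 n) -> all (gtn n.+1) s.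
Proof.
by move=> /perm_all->; apply/allP => i; rewrite mem_iota => /andP[].
Qed.

Lemma iota1S n : perm_eq (iota 1 n.+1) (n.+1 :: iota 1 n).
Proof. by rewrite -{1}[n.+1]addn1 iotaD perm_catC add1n. Qed.

Lemma forest_ins_forest n F F' :
  forest n F -> F' \in forest_ins n.+1 F ->
  forest n.+1 F' /\ forest_rem n.+1 F' = F.
Proof.
case/and4P=> _ iF lF sF F'ins.
have Fa := all_gt_iota lF.
split; last first.
  apply: forest_insK F'ins; apply/negP => /(allP Fa) /=.
  by rewrite ltnn.
apply/and4P; split=> //.
- exact: forest_ins_increasing F'ins.
- apply: (perm_trans (forest_ins_labels F'ins)).
  by rewrite (perm_sym (_ :: _)) (perm_trans (iota1S n)) // perm_cons perm_sym.
- exact: forest_ins_sorted F'ins.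
Qed.

Lemma forest_rem_forest n F :
  forest n.+1 F ->
  forest n (forest_rem n.+1 F) /\ F \in forest_ins n.+1 (forest_rem n.+1 F).
Proof.
case/and4P=> _ iF lF sF.
have F_ins : F \in forest_ins n.+1 (forest_rem n.+1 F).
  apply: forest_remK => //.
    by rewrite (perm_all _ lF); apply/allP => i; rewrite mem_iota => /andP[].
  by have /permP-> := lF; rewrite count_uniq_mem ?iota_uniq // mem_iota /= add1n ltnSn.
split=> //; apply/and4P; split=> //.
- exact: forest_rem_increasing.
- rewrite -(perm_cons n.+1) -(permPl (forest_ins_labels F_ins)).
  exact: perm_trans lF (iota1S n).
- exact: forest_rem_sorted.
Qed.

Fixpoint forests (n : nat) : seq (seq planted) :=
  if n is n'.+1 then flatten [seq forest_ins n F | F <- forests n'] else [:: [::]].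

Lemma forests_enum n :
  uniq (forests n) /\ (forall F, F \in forests n <-> forest n F).
Proof.
elim: n => [|n [IHu IHn]].
  split=> // F; rewrite inE; split=> [/eqP->//|/and4P[_ _ /perm_size]].
  by case: F.
apply: (enum_children (par := forest_rem n.+1) IHu IHn).
- by move=> F _; apply: forest_ins_uniq.
- by move=> F F'; apply: forest_ins_forest.
- by move=> F; apply: forest_rem_forest.
Qed.

Lemma forest_size_labels n F : forest n F -> size (forest_labels F) = n.
Proof. by case/and4P=> _ _ /perm_size->; rewrite size_iota. Qed.

(** The three summands are the insertions at an outer leaf, the insertions at
    a middle or right leaf, and the new tree. *)
Lemma sum_forest_ins a F (g : nat -> nat -> nat) :
  \sum_(F' <- forest_ins a F) g (size F') (forest_outer_leaves F') =
    forest_outer_leaves F * g (size F) (forest_outer_leaves F)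
      + forest_mr_leaves F * g (size F) (forest_outer_leaves F).+1
      + g (size F).+1 (forest_outer_leaves F).+1.
Proof.
rewrite /forest_outer_leaves /forest_mr_leaves.
elim: F g => [|[b t] F IHF] g; first by rewrite /= big_seq1 !big_nil big_seq1.
rewrite /= big_cat !big_map !big_cons /=.
set L := \sum_(u <- F) outer_leaves u in IHF *.
set M := \sum_(u <- F) planted_mr_leaves u in IHF *.
rewrite (eq_big_seq (fun t' => g (size F).+1 (tern_left_leaves t' + L))); last first.
  by case=> [/tern_ins_labels/perm_size //|*]; rewrite big_cons -/L.
rewrite (sum_tern_ins a t (fun j => g _ (j + L))).
rewrite (eq_bigr (fun F' =>
  g (size F').+1 (forest_outer_leaves F' + outer_leaves (b, t)))).
  rewrite (IHF (fun k j => g k.+1 (j + _))) /outer_leaves /planted_mr_leaves /=.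
  rewrite (addnC L) !addSn (addnC L); lia.
by move=> F' _; rewrite big_cons addnC.
Qed.

(** In [sum_forest_ins] the number of middle and right leaves depends on the
    forest only through [n], [k] and the number of outer leaves
    ([forest_leaves]), which makes the recurrence close. *)
Lemma xD_coef_forests n k l :
  xD_coef n k l =
  count (fun F => (size F == k) && (forest_outer_leaves F == l)) (forests n).
Proof.
elim: n k l => [|n IHn] k l.
  by rewrite /= /forest_outer_leaves big_nil addn0 !(eq_sym 0).
rewrite count_sum /= big_flatten big_map /=.
under eq_bigr => F _ do
  rewrite (sum_forest_ins _ _ (fun i j => (i == k) && (j == l) : nat)).
rewrite !big_split /=.
case: l => [|l].
  rewrite !big1 // => F _; rewrite ?andbF ?muln0 //.
  by case: (forest_outer_leaves F) => [|j]; rewrite ?mul0n // andbF muln0.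
congr (_ + _ + _).
- rewrite IHn count_sum big_distrr /=; apply: eq_bigr => F _.
  by case: (_ =P l.+1) => [->//|]; rewrite andbF !muln0.
- rewrite IHn count_sum big_distrr /=; apply: eq_big_seq => F /(forests_enum n).2 fF.
  have := forest_leaves F; rewrite (forest_size_labels fF) eqSS.
  by case: eqP => [->|]; case: eqP => [->|]; rewrite ?muln0 //= !muln1; lia.
- case: k => [|k]; first by rewrite big1.
  by rewrite IHn count_sum.
Qed.

(** * Stirling permutations *)

(** Reads a subsequence as a choice of increasing positions, one at a time. *)
Lemma subseq_consP (T : eqType) (x0 y : T) (s1 s : seq T) :
  reflect (exists i, [/\ i < size s, nth x0 s i = y & subseq s1 (drop i.+1 s)])
          (subseq (y :: s1) s).
Proof.
apply: (iffP idP) => [|[i [i_s <- s1s]]]; last first.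
  apply: subseq_trans (drop_subseq s i).
  by rewrite (drop_nth x0 i_s) /= eqxx.
elim: s => //= z s IHs; case: eqP => [->|_ /IHs[i [i_s Ei s1s]]].
  by exists 0; rewrite drop0.
by exists i.+1.
Qed.

(** The condition on Stirling permutations, phrased by subsequences instead of
    positions so that it passes to subwords without reindexing. *)
Definition valley_free (s : seq nat) := forall x z, subseq [:: x; z; x] s -> x <= z.

Lemma valley_freeP (s : seq nat) :
  valley_free s <->
  (forall i t j, 1 <= i -> i < t -> t < j -> j <= size s ->
    entry s i = entry s j -> entry s i <= entry s t).
Proof.
split=> [vf [|i] [|t] [|j] // _ it tj js Eij|vf x z].
  have [i_s t_s j_s] : [/\ i < size s, t - i.+1 < size s - i.+1
    & j - t.+1 < size s - t.+1] by split; lia.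
  have [Et Ej] : i.+1 + (t - i.+1) = t /\ t.+1 + (j - t.+1) = j by lia.
  apply: vf; apply/(subseq_consP 0); exists i; split=> //.
  apply/(subseq_consP 0); exists (t - i.+1); rewrite size_drop nth_drop Et; split=> //.
  rewrite drop_drop addSn addnC Et sub1seq [entry s _]Eij.
  by apply/(nthP 0); exists (j - t.+1); rewrite ?size_drop // nth_drop Ej.
case/(subseq_consP 0) => i [i_s Ei /(subseq_consP 0)[t [_ Et]]].
rewrite drop_drop sub1seq => /(nthP 0)[j].
move: Et; rewrite size_drop !nth_drop => Et js Ej.
have [it tj] : i.+1 < (i.+1 + t).+1 /\ (i.+1 + t).+1 < (t.+1 + i.+1 + j).+1 by lia.
have {}js : (t.+1 + i.+1 + j).+1 <= size s by rewrite -ltn_subRL.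
rewrite -Ei -Et; apply: (vf i.+1 _ _ isT it tj js).
by rewrite /entry [LHS]/= Ei -Ej.
Qed.

Definition stirling_multiset n := flatten [seq [:: i; i] | i <- iota 1 n].

Lemma size_stirling_multiset n : size (stirling_multiset n) = 2 * n.
Proof.
have sz m : size (flatten [seq [:: i; i] | i <- iota m n]) = 2 * n; last exact: sz.
by elim: n m => //= n IHn m; rewrite IHn; lia.
Qed.

Lemma mem_stirling_multiset n i : (i \in stirling_multiset n) = (0 < i <= n).
Proof.
transitivity (i \in iota 1 n); last by rewrite mem_iota; lia.
by rewrite /stirling_multiset; elim: n 1 => //= n IHn m; rewrite !inE IHn orbA orbb.
Qed.

Lemma stirling_multisetS n :
  perm_eq (stirling_multiset n.+1) [:: n.+1, n.+1 & stirling_multiset n].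
Proof.
rewrite /stirling_multiset -{1}[n.+1]addn1 iotaD map_cat flatten_cat /= add1n.
by rewrite perm_catC.
Qed.

Lemma stirling_permP n s :
  is_stirling_perm n s <-> perm_eq s (stirling_multiset n) /\ valley_free s.
Proof.
split=> -[ps vf]; split=> //; have := perm_size ps; rewrite size_stirling_multiset => sz.
  by apply/valley_freeP; rewrite sz.
by move/valley_freeP: vf; rewrite sz.
Qed.

Fixpoint double_ins (a : nat) (s : seq nat) : seq (seq nat) :=
  [:: a, a & s] ::
    (if s is x :: s' then [seq x :: u | u <- double_ins a s'] else [::]).

(** The head of the list is the same for every word, but the recursion
    computes only on a constructor. *)
Lemma double_insE a s : double_ins a s =
  [:: a, a & s] ::
    (if s is x :: s' then [seq x :: u | u <- double_ins a s'] else [::]).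
Proof. by case: s. Qed.

Lemma mem_double_ins a x s u :
  u \in double_ins a (x :: s) ->
  u = [:: a, a, x & s] \/ exists2 u', u' \in double_ins a s & u = x :: u'.
Proof.
by rewrite /= in_cons => /orP[/eqP->|/mapP[u' ? ->]]; [left|right; exists u'].
Qed.

Lemma double_ins_perm a s u : u \in double_ins a s -> perm_eq u [:: a, a & s].
Proof.
elim: s u => [|x s IHs] u; first by rewrite inE => /eqP->.
case/mem_double_ins=> [->//|[u' /IHs u'_perm ->]].
rewrite -(perm_cons x) in u'_perm; rewrite (permPl u'_perm).
by apply/permP => p /=; lia.
Qed.

Lemma double_ins_uniq a s : a \notin s -> uniq (double_ins a s).
Proof.
elim: s => // x s IHs; rewrite in_cons negb_or double_insE /= => /andP[ax as_].
rewrite map_inj_uniq ?IHs ?andbT //; last by move=> ? ? [].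
by apply/mapP => -[u _ [E]]; rewrite E eqxx in ax.
Qed.

Lemma filter_predC1_id (T : eqType) (a : T) (s : seq T) :
  a \notin s -> filter (predC1 a) s = s.
Proof.
by move=> as_; apply/all_filterP/allP => x xs /=; apply: contraNneq as_ => <-.
Qed.

Lemma double_insK a s u :
  a \notin s -> u \in double_ins a s -> filter (predC1 a) u = s.
Proof.
move=> as_.
have Es := filter_predC1_id as_.
elim: s u as_ Es => [|x s IHs] u as_ Es.
  by rewrite inE => /eqP->; rewrite /= eqxx.
case/mem_double_ins=> [->|[u' u'_ins ->]].
- by rewrite [LHS]/= eqxx /= -[RHS]Es.
- move: as_ Es; rewrite in_cons negb_or eq_sym /= => /andP[-> as_] [Es].
  by rewrite IHs.
Qed.

(** A forbidden subword [x z x] of the new word cannot use the letter [a]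
    twice, as nothing stands between its two copies, nor once, as [a] is the
    largest letter; so it already occurs in the old word. *)
Lemma double_ins_valley_free a s u :
  all (gtn a) s -> valley_free s -> u \in double_ins a s -> valley_free u.
Proof.
move=> sa vf u_ins x z xzx.
have as_ : a \notin s by apply/negP => /(allP sa) /=; rewrite ltnn.
have Es := double_insK as_ u_ins.
have [xa|xa] := eqVneq x a; last first.
  have [->|za] := eqVneq z a.
    apply/ltnW/(allP sa : forall y, y \in s -> y < a).
    by rewrite -Es mem_filter /= xa (mem_subseq xzx) ?mem_head.
  by apply: vf; rewrite -Es subseq_filter /= xa za.
rewrite {}xa in xzx *; rewrite leqNgt; apply/negP => za.
move: {vf Es sa} xzx; apply/negP.
elim: s u as_ u_ins => [|y s IHs] u as_.
  by rewrite inE => /eqP->; rewrite /= eqxx (ltn_eqF za).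
case/mem_double_ins=> [->|[u' u'_ins ->]].
- apply: contra as_ => sub.
  have {}sub : subseq [:: z; a] (y :: s) by move: sub; rewrite /= eqxx (ltn_eqF za).
  by apply: (mem_subseq sub); rewrite !inE eqxx orbT.
- move: as_; rewrite in_cons negb_or => /andP[/negPf ay as_].
  by rewrite [subseq _ _]/= ay; apply: IHs.
Qed.

(** Between the two copies of the largest letter [a] only letters at least
    [a] are allowed, and there is no third copy: they are adjacent. *)
Lemma double_remK a s :
  all (geq a) s -> count_mem a s = 2 -> valley_free s ->
  s \in double_ins a (filter (predC1 a) s).
Proof.
elim: s => //= x s IHs /andP[xa sa]; case: eqP => [->|/eqP xa'] Ea vf /=.
  case: s sa Ea vf {IHs} => //= y s /andP[ya sa].
  case: eqP => [-> [Ea] _|/eqP ya' [Ea] vf]; rewrite !add0n in Ea.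
    rewrite /= filter_predC1_id ?double_insE ?mem_head //.
    by rewrite -has_pred1 has_count Ea.
  have /vf : subseq [:: a; y; a] [:: a, y & s].
    by rewrite /= !eqxx sub1seq -has_pred1 has_count; rewrite Ea.
  by rewrite leqNgt ltn_neqAle ya' ya.
rewrite in_cons map_f ?orbT //; apply: IHs => // y z yzy; apply: vf.
exact: subseq_trans yzy (subseq_cons s x).
Qed.

Lemma stirling_perm_max n s : is_stirling_perm n s -> all (gtn n.+1) s.
Proof.
case/stirling_permP=> ps _; rewrite (perm_all _ ps).
by apply/allP => i; rewrite mem_stirling_multiset => /andP[].
Qed.

Lemma stirling_perm_max_notin n s : is_stirling_perm n s -> n.+1 \notin s.
Proof. by move/stirling_perm_max/allP=> h; apply/negP => /h /=; rewrite ltnn. Qed.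

Fixpoint stirling_perms (n : nat) : seq (seq nat) :=
  if n is n'.+1 then flatten [seq double_ins n s | s <- stirling_perms n'] else [:: [::]].

Lemma stirling_perms_enum n :
  uniq (stirling_perms n) /\ (forall s, s \in stirling_perms n <-> is_stirling_perm n s).
Proof.
elim: n => [|n [IHu IHn]].
  split=> // s; rewrite inE; split=> [/eqP->|[/perm_size]]; last by case: s.
  by apply/stirling_permP; split.
apply: (enum_children (par := filter (predC1 n.+1)) IHu IHn).
- by move=> s /stirling_perm_max_notin/double_ins_uniq.
- move=> s u sP u_ins; split; last exact: double_insK (stirling_perm_max_notin sP) u_ins.
  have [ps vf] := (stirling_permP n s).1 sP.
  apply/stirling_permP; split.
    rewrite (permPl (double_ins_perm u_ins)) perm_sym (permPl (stirling_multisetS n)).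
    by rewrite !perm_cons perm_sym.
  exact: double_ins_valley_free (stirling_perm_max sP) vf u_ins.
- move=> s /stirling_permP[ps vf]; split; last first.
    apply: double_remK => //.
      by rewrite (perm_all _ ps); apply/allP => i; rewrite mem_stirling_multiset => /andP[].
    have /permP-> := ps; have /permP-> := stirling_multisetS n.
    rewrite /= eqxx; congr _.+2; apply/count_memPn.
    by rewrite mem_stirling_multiset ltnn andbF.
  apply/stirling_permP; split.
    have /permPl-> := perm_filter (predC1 n.+1) (perm_trans ps (stirling_multisetS n)).
    by rewrite /= eqxx /= filter_predC1_id // mem_stirling_multiset ltnn andbF.
  by move=> x z xzx; apply: vf; apply: subseq_trans xzx (filter_subseq _ _).
Qed.

(** Descents of [s] preceded by the letter [p] and followed by 0; keeping the
    previous letter as an argument allows induction on [s]. *)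
Fixpoint descents_from (p : nat) (s : seq nat) : nat :=
  if s is x :: s' then (x < p) + descents_from x s' else (0 < p : nat).

Lemma descentsE s : descents s = descents_from 0 s.
Proof.
have gen p : count (fun i => nth 0 (p :: s) i.+1 < nth 0 (p :: s) i)
    (iota 0 (size s).+1) = descents_from p s; last exact: gen.
elim: s p => [|x s IHs] p; first by rewrite /= addn0.
rewrite [RHS]/= -IHs -[_.+1 in LHS]/(1 + (size s).+1) iotaD count_cat.
by rewrite (iotaDl 1 0) count_map [in LHS]/= addn0.
Qed.

(** Around the inserted pair there is always exactly one descent, its right
    end.  In a gap that was a descent the number is unchanged, in any of the
    other gaps, out of [size s + 1], it grows by one.  The term subtracted from
    the number of gaps is moved to the left to stay in the naturals. *)
Lemma sum_double_ins a p s (g : nat -> nat) :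
  p < a -> all (gtn a) s ->
  \sum_(u <- double_ins a s) g (descents_from p u)
      + descents_from p s * g (descents_from p s).+1 =
    descents_from p s * g (descents_from p s)
      + (size s).+1 * g (descents_from p s).+1.
Proof.
elim: s p g => [|x s IHs] p g pa; rewrite double_insE.
  rewrite big_seq1 /= ltnn ltnNge (ltnW pa) (leq_ltn_trans _ pa) // !add0n => _.
  by case: p {pa} => [|p] /=; rewrite ?mul0n ?mul1n ?add0n ?addn0 // addnC.
case/andP=> xa sa; rewrite big_cons big_map /= ltnn.
have := IHs x (fun j => g ((x < p) + j)) xa sa.
rewrite (xa : x < a) (ltnNge a p) (ltnW pa) /=.
case: (ltnP x p) => xp /=; rewrite ?add0n ?add1n; nia.
Qed.

(** For [k = 1] the last term of the recurrence is a coefficient with [k = 0],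
    hence zero, and what remains is [sum_double_ins] with [2n + 1] gaps.  The
    induction starts at order 1: the empty word has no descent and
    does not fit. *)
Lemma xD_coef_stirling n l : 0 < n ->
  xD_coef n.+1 1 l = count (fun s => descents s == l) (stirling_perms n).
Proof.
case: n => // n _; elim: n l => [|n IHn] l.
  by case: l => [|[|[|l]]] //; rewrite xD_coef_out.
rewrite count_sum [stirling_perms _]/= big_flatten big_map.
have insE s : s \in stirling_perms n.+1 ->
    let d := descents s in
    \sum_(u <- double_ins n.+2 s) (descents u == l : nat) + d * (d.+1 == l) =
      d * (d == l) + (2 * n.+1).+1 * (d.+1 == l).
  move=> /(stirling_perms_enum n.+1).2 sP /=.
  under eq_bigr => u _ do rewrite descentsE.
  rewrite descentsE (sum_double_ins (fun j => j == l : nat)) ?stirling_perm_max //.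
  by have [/perm_size-> _] := (stirling_permP _ _).1 sP; rewrite size_stirling_multiset.
case: l insE => [|l] insE.
  rewrite big1_seq // => s /andP[_ /insE] /=.
  by case: (descents s) => [|d]; rewrite !muln0 !addn0.
rewrite xD_coefS xD_coef0 // addn0 !IHn !count_sum !big_distrr -big_split /=.
apply: eq_big_seq => s /insE /=; rewrite eqSS.
move: (\sum_(u <- _) _) => S.
case: (descents s =P l) => [->|_]; first by rewrite (ltn_eqF (ltnSn l)); lia.
by case: eqP => [->|_]; lia.
Qed.

Local Open Scope ring_scope.

(** * The operator expansion and its combinatorial coefficients *)

Theorem theorem12 :
  exists C : nat -> nat -> nat -> nat,
  (* expansion of (x D_G)^n *)
  (forall (K : comNzRingType) (A : comAlgType K) (x y : A) (D : A -> A),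
     grammar_derivation (gramG K) [tuple x; y] D ->
     forall n : nat, (1 <= n)%N -> forall f : A,
     iter n (fun g => x * D g) f =
     \sum_(1 <= k < n.+1) \sum_(k <= l < n.+1)
        (C n k l)%:R * (x ^+ l * y ^+ (2 * n - k - l)) * iter k D f) /\
  (* on polynomials the coefficients of the expansion are determined *)
  (forall n : nat, (1 <= n)%N -> forall c : nat -> nat -> rat,
     (forall f : {mpoly rat[2]},
        iter n (fun g => 'X_0 * grammar_D (gramG rat) g) f =
        \sum_(1 <= k < n.+1) \sum_(k <= l < n.+1)
           c k l *: ('X_0 ^+ l * 'X_1 ^+ (2 * n - k - l)
                       * iter k (grammar_D (gramG rat)) f)) ->
     forall k l : nat, (1 <= k <= l)%N -> (l <= n)%N ->
       c k l = (C n k l)%:R) /\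
  (* coefficients outside the range of summation *)
  (forall n k l : nat, (1 <= n)%N -> ~~ [&& 1 <= k, k <= l & l <= n]%N ->
     C n k l = 0%N) /\
  (* recurrence *)
  (forall n k l : nat, (1 <= n)%N -> (1 <= k)%N -> (1 <= l)%N ->
     (C n.+1 k l)%:Z =
       l%:Z * (C n k l)%:Z
       + ((2 * n)%:Z - k%:Z - l%:Z + 1) * (C n k l.-1)%:Z
       + (C n k.-1 l.-1)%:Z) /\
  (* initial conditions *)
  (C 1%N 1%N 1%N = 1%N /\
   forall k l : nat, (k, l) <> (1%N, 1%N) -> C 1%N k l = 0%N) /\
  (* ternary forests *)
  (forall n k l : nat, (1 <= n)%N ->
     has_card (fun F : seq planted =>
                 is_forest n k F /\
                 (forest_mr_leaves F)%:Z = (2 * n)%:Z - k%:Z - l%:Z)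
              (C n k l)) /\
  (* second-order Eulerian numbers *)
  (forall n l : nat, (1 <= n)%N ->
     has_card (fun s : seq nat => is_stirling_perm n s /\ descents s = l)
              (C n.+1 1%N l)).
Proof.
exists xD_coef; do !split.
- by move=> K A x y D D_G n n_gt0 f; apply: xD_expansion.
- by move=> n n_gt0 c expc k l; apply: xD_expansion_unique.
- move=> n [|k] l n_gt0; first by rewrite xD_coef0.
  exact: xD_coef_out.
- by move=> n k l _; apply: xD_coef_rec_int.
- move=> [|k] l kl; first by rewrite xD_coef0.
  by apply: xD_coef_out; apply/negP => kl1; apply: kl; congr pair; lia.
- move=> n k l _; rewrite xD_coef_forests.
  have [uF memF] := forests_enum n.
  apply: (has_card_filter uF memF) => F.
  have mrE : forest n F -> size F = k ->
      (forest_mr_leaves F)%:Z = (2 * n)%:Z - k%:Z - l%:Z <->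
      forest_outer_leaves F = l.
    move=> isF sF; have := forest_leaves F; rewrite (forest_size_labels isF) sF.
    move: (forest_outer_leaves F) (forest_mr_leaves F) => L M; lia.
  split=> [[isF mrF]|[isF /andP[/eqP sF /eqP lF]]]; last first.
    by split; [rewrite -sF|apply/mrE].
  have sF : size F = k by case/and4P: isF => /eqP.
  have fF : forest n F by rewrite /forest sF.
  by split=> //; rewrite sF eqxx; apply/eqP/mrE.
- move=> n l n_gt0; rewrite xD_coef_stirling //.
  have [uS memS] := stirling_perms_enum n.
  apply: (has_card_filter uS memS) => s.
  by split=> -[sP /eqP ds].
Qed.
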